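(* Every hyperarchimedean residuated lattice has the Boolean Lifting Property (BLP), but the converse is not true: there exists a residuated lattice that has BLP and is not hyperarchimedean.
   Context: A residuated lattice is a commutative integral bounded one: a structure $(A,\vee ,\wedge ,\odot ,\rightarrow ,0,1)$ such that $(A,\vee ,\wedge ,0,1)$ is a bounded lattice, $(A,\odot ,1)$ is a commutative monoid, and $a\leq b\rightarrow c$ iff $a\odot b\leq c$ for all $a,b,c$. Write $a\leftrightarrow b=(a\rightarrow b)\wedge (b\rightarrow a)$ and $a^n$ for the $n$-fold $\odot$-power. $\mathcal{B}(A)$ is the set of complemented elements of the bounded lattice reduct of $A$. An element $a$ is archimedean iff $a^n\in \mathcal{B}(A)$ for some $n\geq 1$; $A$ is hyperarchimedean iff all its elements are archimedean. A filter of $A$ is a nonempty subset closed under $\odot$ and upward closed. For a filter $F$, $A/F$ is the quotient residuated lattice by the congruence $a\equiv b$ iff $a\leftrightarrow b\in F$, with classes $a/F$. $F$ has BLP iff for every $f\in \mathcal{B}(A/F)$ there is $e\in \mathcal{B}(A)$ with $e/F=f$. $A$ has BLP iff all its filters have BLP. *)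

(* Defs.v *)
From HB Require Import structures.
From mathcomp Require Import all_boot all_order.
From mathcomp Require Import boolp.

Set Implicit Arguments.
Unset Strict Implicit.
Unset Printing Implicit Defensive.

Import Order.TTheory.
Local Open Scope order_scope.
Local Open Scope quotient_scope.

Reserved Notation "a \odot b" (at level 40, left associativity).
Reserved Notation "a \imp b" (at level 55, right associativity).
Reserved Notation "a \biimp b" (at level 55, no associativity).

(** The bounded lattice reduct is a [tbLatticeType], with [\bot] for 0 and
    [\top] for 1; the monoid unit being [\top] is the integrality.  The lattice
    need not be distributive, and \bot = \top is allowed. *)
HB.mixin Record isResiduatedLattice (d : Order.disp_t) A
    of Order.TBLattice d A := {
  rmul : A -> A -> A;
  rimp : A -> A -> A;
  rmulA : associative rmul;
  rmulC : commutative rmul;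
  rmul1x : left_id (\top : A) rmul;
  residuation : forall a b c : A, (a <= rimp b c) = (rmul a b <= c);
}.

#[short(type="residuatedLatticeType")]
HB.structure Definition ResiduatedLattice (d : Order.disp_t) :=
  { A of isResiduatedLattice d A & Order.TBLattice d A }.

Notation "a \odot b" := (rmul a b) : order_scope.
Notation "a \imp b" := (rimp a b) : order_scope.
Notation "a \biimp b" := ((a \imp b) `&` (b \imp a)) : order_scope.

Definition rpow (d : Order.disp_t) (A : residuatedLatticeType d)
  (a : A) (n : nat) : A := iter n (rmul a) \top.

(** The Boolean center: B(A) depends only on the bounded lattice reduct. *)
Definition boolean_center (d : Order.disp_t) (L : tbLatticeType d) : L -> Prop :=
  fun a => exists b : L, a `|` b = \top /\ a `&` b = \bot.

Definition archimedean_elt (d : Order.disp_t) (A : residuatedLatticeType d)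
  (a : A) : Prop := exists n : nat, (1 <= n)%N /\ boolean_center (rpow a n).

Definition hyperarchimedean (d : Order.disp_t)
  (A : residuatedLatticeType d) : Prop := forall a : A, archimedean_elt a.

(** Filters need not be proper. *)
Record rfilter (d : Order.disp_t) (A : residuatedLatticeType d) := RFilter {
  rfilter_set :> A -> Prop;
  rfilter_neq0 : exists a : A, rfilter_set a;
  rfilter_mul : forall a b : A,
    rfilter_set a -> rfilter_set b -> rfilter_set (a \odot b);
  rfilter_up : forall a b : A, rfilter_set a -> a <= b -> rfilter_set b
}.

Section BasicTheory.
Variables (d : Order.disp_t) (A : residuatedLatticeType d).
Implicit Types a b c x y z : A.

Lemma rmulx1 : right_id \top (@rmul d A).
Proof. by move=> x; rewrite rmulC rmul1x. Qed.

Lemma rmul_impl a b : (a \imp b) \odot a <= b.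
Proof. by rewrite -residuation. Qed.

Lemma ler_rmul a b c : a <= b -> a \odot c <= b \odot c.
Proof. by move=> h; rewrite -residuation (le_trans h) // residuation. Qed.

Lemma ler_rmul2 a b x y : a <= b -> x <= y -> a \odot x <= b \odot y.
Proof.
move=> h k; apply: le_trans (ler_rmul _ h) _.
by rewrite ![b \odot _]rmulC; apply: ler_rmul.
Qed.

Lemma rmul_lel a b : a \odot b <= a.
Proof. by rewrite -[X in _ <= X]rmulx1 ler_rmul2 // lex1. Qed.

Lemma rmul_ler a b : a \odot b <= b.
Proof. by rewrite rmulC rmul_lel. Qed.

Lemma rimp_top a b : a <= b -> a \imp b = \top.
Proof. by move=> h; apply/eqP; rewrite -le1x residuation rmul1x. Qed.

Lemma rimp_meetr a b c : a \imp (b `&` c) = (a \imp b) `&` (a \imp c).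
Proof.
apply/le_anti/andP; split.
  rewrite lexI !residuation.
  by rewrite !(le_trans (rmul_impl _ _)) ?leIl ?leIr.
rewrite residuation lexI -!residuation.
by rewrite leIl leIr.
Qed.

Lemma rimp_rmul a b c : a \imp (b \imp c) = (a \odot b) \imp c.
Proof.
apply/le_anti/andP; split; first by rewrite residuation rmulA -!residuation.
by rewrite residuation residuation -rmulA -residuation.
Qed.

Lemma rimp_trans a b c : (a \imp b) \odot (b \imp c) <= a \imp c.
Proof.
rewrite residuation [X in X \odot a]rmulC -rmulA.
by apply: le_trans (rmul_impl b c); rewrite ler_rmul2 // rmul_impl.
Qed.

End BasicTheory.

Section Quotient.
Variables (d : Order.disp_t) (A : residuatedLatticeType d) (F : rfilter A).
Implicit Types a b c x y z : A.

Lemma rfilter_top : F \top.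
Proof. by case: (rfilter_neq0 F) => a /rfilter_up; apply; apply: lex1. Qed.

Lemma rfilter_meet a b : F (a `&` b) <-> F a /\ F b.
Proof.
split=> [h|[ha hb]]; first by split; apply: rfilter_up h _; rewrite ?leIl ?leIr.
apply: rfilter_up (rfilter_mul ha hb) _.
by rewrite lexI rmul_lel rmul_ler.
Qed.

Definition filter_eq : rel A := fun a b => `[< F (a \biimp b) >].

Lemma filter_eqP a b : reflect (F (a \imp b) /\ F (b \imp a)) (filter_eq a b).
Proof. by apply: (iffP (asboolP _)) => /rfilter_meet. Qed.

Lemma filter_imp_trans b a c : F (a \imp b) -> F (b \imp c) -> F (a \imp c).
Proof. by move=> h k; apply: rfilter_up (rfilter_mul h k) (rimp_trans _ _ _). Qed.

Lemma filter_eq_refl : reflexive filter_eq.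
Proof.
by move=> a; apply/filter_eqP; rewrite rimp_top //; split; apply: rfilter_top.
Qed.

Lemma filter_eq_sym : symmetric filter_eq.
Proof. by move=> a b; apply/filter_eqP/filter_eqP => -[]. Qed.

Lemma filter_eq_trans : transitive filter_eq.
Proof.
move=> b a c /filter_eqP[h h'] /filter_eqP[k k']; apply/filter_eqP.
by split; [apply: filter_imp_trans h k | apply: filter_imp_trans k' h'].
Qed.

Canonical filter_equiv :=
  EquivRel filter_eq filter_eq_refl filter_eq_sym filter_eq_trans.

Definition rquot := {eq_quot filter_eq}.
HB.instance Definition _ := Choice.on rquot.
HB.instance Definition _ := EqQuotient.on rquot.

Lemma rquotP a b : reflect (\pi_rquot a = \pi_rquot b) (filter_eq a b).
Proof. exact: (iffP (@eqquotP _ _ rquot a b)). Qed.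

Lemma filter_imp_le a b : a <= b -> F (a \imp b).
Proof. by move=> h; rewrite rimp_top //; apply: rfilter_top. Qed.

Definition qmeet : rquot -> rquot -> rquot := lift_op2 rquot (@Order.meet d A).
Definition qjoin : rquot -> rquot -> rquot := lift_op2 rquot (@Order.join d A).
Definition qmul : rquot -> rquot -> rquot := lift_op2 rquot (@rmul d A).
Definition qimp : rquot -> rquot -> rquot := lift_op2 rquot (@rimp d A).

(** A binary operation that is compatible with "F (_ \imp _)" passes to the
    quotient. *)
Lemma pi_lift2 (op : A -> A -> A) :
  (forall a a' b b', filter_eq a a' -> filter_eq b b' ->
     F (op a b \imp op a' b')) ->
  forall a b,
    \pi_rquot (op a b) =
      \pi_rquot (op (repr (\pi_rquot a)) (repr (\pi_rquot b))).
Proof.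
move=> h a b; apply/rquotP/filter_eqP.
have ra x : filter_eq x (repr (\pi_rquot x)) by apply/rquotP; rewrite reprK.
by split; apply: h; rewrite // filter_eq_sym.
Qed.

Lemma pi_qmeet : {morph \pi_rquot : a b / a `&` b >-> qmeet a b}.
Proof.
move=> a b; rewrite /qmeet -lock; apply: pi_lift2 => {}a a' {}b b'.
case/filter_eqP=> ha _ /filter_eqP[hb _].
rewrite rimp_meetr; apply/rfilter_meet; split.
  exact: filter_imp_trans (filter_imp_le (leIl a b)) ha.
exact: filter_imp_trans (filter_imp_le (leIr b a)) hb.
Qed.

Lemma pi_qjoin : {morph \pi_rquot : a b / a `|` b >-> qjoin a b}.
Proof.
move=> a b; rewrite /qjoin -lock; apply: pi_lift2 => {}a a' {}b b'.
case/filter_eqP=> ha _ /filter_eqP[hb _].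
apply: rfilter_up (rfilter_mul ha hb) _.
rewrite residuation rmulC -residuation leUx; apply/andP; split.
  rewrite residuation rmulC -residuation; apply: le_trans (rmul_lel _ _) _.
  by rewrite residuation (le_trans (rmul_impl _ _)) // leUl.
rewrite residuation rmulC -residuation; apply: le_trans (rmul_ler _ _) _.
by rewrite residuation (le_trans (rmul_impl _ _)) // leUr.
Qed.

Lemma pi_qmul : {morph \pi_rquot : a b / a \odot b >-> qmul a b}.
Proof.
move=> a b; rewrite /qmul -lock; apply: pi_lift2 => {}a a' {}b b'.
case/filter_eqP=> ha _ /filter_eqP[hb _].
apply: rfilter_up (rfilter_mul ha hb) _.
rewrite residuation.
have -> : (a \imp a') \odot (b \imp b') \odot (a \odot b) =
          ((a \imp a') \odot a) \odot ((b \imp b') \odot b).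
  by rewrite -!rmulA; congr (_ \odot _); rewrite !rmulA [X in X \odot b]rmulC.
by apply: ler_rmul2; apply: rmul_impl.
Qed.

Lemma pi_qimp : {morph \pi_rquot : a b / a \imp b >-> qimp a b}.
Proof.
move=> a b; rewrite /qimp -lock; apply: pi_lift2 => {}a a' {}b b'.
case/filter_eqP=> _ ha /filter_eqP[hb _].
apply: rfilter_up (rfilter_mul ha hb) _.
rewrite residuation residuation.
have -> : (a' \imp a) \odot (b \imp b') \odot (a \imp b) \odot a' =
   ((b \imp b') \odot ((a \imp b) \odot ((a' \imp a) \odot a'))).
  rewrite -rmulA [X in X \odot _]rmulC -rmulA; congr (_ \odot _).
  by rewrite rmulA [X in X \odot _]rmulC -rmulA.
apply: le_trans (rmul_impl b b'); apply: ler_rmul2 => //.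
apply: le_trans (rmul_impl a b); apply: ler_rmul2 => //.
exact: rmul_impl.
Qed.

Let qE := (pi_qmeet, pi_qjoin, pi_qmul, pi_qimp).

Definition qle (x y : rquot) : bool := qmeet x y == x.

Lemma qmeetC : commutative qmeet.
Proof. by elim/quotW=> a; elim/quotW=> b; rewrite -!qE meetC. Qed.

Lemma qjoinC : commutative qjoin.
Proof. by elim/quotW=> a; elim/quotW=> b; rewrite -!qE joinC. Qed.

Lemma qmeetA : associative qmeet.
Proof.
by elim/quotW=> a; elim/quotW=> b; elim/quotW=> c; rewrite -!qE meetA.
Qed.

Lemma qjoinA : associative qjoin.
Proof.
by elim/quotW=> a; elim/quotW=> b; elim/quotW=> c; rewrite -!qE joinA.
Qed.

Lemma qmeetxx : idempotent_op qmeet.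
Proof. by elim/quotW=> a; rewrite -!qE meetxx. Qed.

Lemma qjoinKI (y x : rquot) : qmeet x (qjoin x y) = x.
Proof. by elim/quotW: x => a; elim/quotW: y => b; rewrite -!qE joinKI. Qed.

Lemma qmeetKU (y x : rquot) : qjoin x (qmeet x y) = x.
Proof. by elim/quotW: x => a; elim/quotW: y => b; rewrite -!qE meetKU. Qed.

Lemma qle_refl : reflexive qle.
Proof. by move=> x; rewrite /qle qmeetxx. Qed.

Lemma qle_anti : antisymmetric qle.
Proof. by move=> x y /andP[/eqP h /eqP k]; rewrite -h qmeetC k. Qed.

Lemma qle_trans : transitive qle.
Proof.
by move=> y x z /eqP h /eqP k; apply/eqP; rewrite -h -qmeetA k.
Qed.

(** a/F <= b/F in the quotient lattice iff a -> b is in F. *)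
Lemma qleP a b : reflect (F (a \imp b)) (qle (\pi_rquot a) (\pi_rquot b)).
Proof.
rewrite /qle -pi_qmeet; apply: (iffP eqP) => [/rquotP/filter_eqP[_]|h].
  by rewrite rimp_meetr => /rfilter_meet[].
apply/rquotP/filter_eqP; split; first exact/filter_imp_le/leIl.
by rewrite rimp_meetr; apply/rfilter_meet; split=> //; apply: filter_imp_le.
Qed.

HB.instance Definition _ :=
  Order.Le_isPOrder.Build d rquot qle_refl qle_anti qle_trans.
HB.instance Definition _ :=
  Order.POrder_isLattice.Build d rquot
    qmeetC qjoinC qmeetA qjoinA qjoinKI qmeetKU (fun _ _ => erefl).

Lemma qle0x (x : rquot) : \pi_rquot \bot <= x.
Proof. by elim/quotW: x => a; apply/qleP/filter_imp_le/le0x. Qed.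

Lemma qlex1 (x : rquot) : x <= \pi_rquot \top.
Proof. by elim/quotW: x => a; apply/qleP/filter_imp_le/lex1. Qed.

HB.instance Definition _ := Order.hasBottom.Build d rquot qle0x.
HB.instance Definition _ := Order.hasTop.Build d rquot qlex1.

Lemma qmulA : associative qmul.
Proof.
by elim/quotW=> a; elim/quotW=> b; elim/quotW=> c; rewrite -!qE rmulA.
Qed.

Lemma qmulC : commutative qmul.
Proof. by elim/quotW=> a; elim/quotW=> b; rewrite -!qE rmulC. Qed.

Lemma qmul1x : left_id (\top : rquot) qmul.
Proof. by elim/quotW=> a; rewrite -qE rmul1x. Qed.

Lemma qresiduation (x y z : rquot) : (x <= qimp y z) = (qmul x y <= z).
Proof.
elim/quotW: x => a; elim/quotW: y => b; elim/quotW: z => c.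
by rewrite -!qE; apply/qleP/qleP; rewrite rimp_rmul.
Qed.

HB.instance Definition _ :=
  isResiduatedLattice.Build d rquot qmulA qmulC qmul1x qresiduation.

(** The canonical surjection is a morphism for the structure just built. *)
Lemma pi_rquotE :
  [/\ {morph \pi_rquot : a b / a `&` b},
      {morph \pi_rquot : a b / a `|` b},
      {morph \pi_rquot : a b / a \odot b},
      {morph \pi_rquot : a b / a \imp b} &
      \pi_rquot \bot = \bot /\ \pi_rquot \top = \top].
Proof.
by split=> [|||| //]; [exact: pi_qmeet | exact: pi_qjoin | exact: pi_qmul
                      | exact: pi_qimp].
Qed.

Definition filter_BLP : Prop :=
  forall f : rquot, boolean_center f ->
    exists e : A, boolean_center e /\ \pi_rquot e = f.

End Quotient.

Definition has_BLP (d : Order.disp_t) (A : residuatedLatticeType d) : Prop :=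
  forall F : rfilter A, filter_BLP F.

(* Main.v *)
Require Import Defs.
From mathcomp Require Import all_boot all_order.
From HB Require Import structures.

(** For the first half, a complemented element of a residuated lattice is
    idempotent.  Hence if the class of [a] modulo a filter is complemented, it
    is also the class of every power [a^n] with [n >= 1]; when [a] is
    archimedean, one of these powers lies in the Boolean center of the algebra
    and lifts the class ([archimedean_lift]).

    The converse fails because a totally ordered residuated lattice always has BLP:
    its quotients are chains too, so only \bot and \top are complemented in them
    ([chain_has_BLP]).  On a bounded chain with the meet as product, every
    element is idempotent, so an archimedean element is complemented, hence
    \bot or \top ([goedel_archimedean]).  A chain with more than two elements,
    such as the lexicographic product of two copies of [bool], therefore has
    BLP without being hyperarchimedean. *)

Set Implicit Arguments.
Unset Strict Implicit.
Unset Printing Implicit Defensive.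

Import Order.TTheory.
Local Open Scope order_scope.
Local Open Scope quotient_scope.

Section ResiduatedLatticeTheory.
Variables (d : Order.disp_t) (A : residuatedLatticeType d).
Implicit Types a b c : A.

Lemma rmul_joinr a b c : a \odot (b `|` c) = a \odot b `|` a \odot c.
Proof.
apply/le_anti/andP; split.
  rewrite rmulC -residuation leUx !residuation ![_ \odot a]rmulC.
  by rewrite leUl leUr.
by rewrite leUx !ler_rmul2 ?leUl ?leUr.
Qed.

Lemma boolean_center_idem a : boolean_center a -> a \odot a = a.
Proof.
case=> b [ab1 ab0].
have ab : a \odot b = \bot.
  by apply/eqP; rewrite -lex0 -ab0 lexI rmul_lel rmul_ler.
by rewrite -[RHS]rmulx1 -ab1 rmul_joinr ab joinx0.
Qed.

Lemma rpow_idem a n : a \odot a = a -> (0 < n)%N -> rpow a n = a.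
Proof.
move=> aa; case: n => // n _; elim: n => [|n IHn]; first exact: rmulx1.
by rewrite /rpow iterS -/(rpow a n.+1) IHn.
Qed.

Lemma boolean_center_bot : boolean_center (\bot : A).
Proof. by exists \top; rewrite join0x meet0x. Qed.

Lemma boolean_center_top : boolean_center (\top : A).
Proof. by exists \bot; rewrite joinx0 meetx0. Qed.

End ResiduatedLatticeTheory.

Section Lifting.
Variables (d : Order.disp_t) (A : residuatedLatticeType d).
Implicit Types (a b : A) (F : rfilter A).

Lemma pi_rpow F a n : \pi_(rquot F) (rpow a n) = rpow (\pi_(rquot F) a) n.
Proof.
have [_ _ piM _ [_ pi1]] := pi_rquotE F.
by elim: n => [|n IHn]; rewrite /rpow ?iterS //= piM -/(rpow _ _) IHn.
Qed.

Lemma archimedean_lift F a :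
    archimedean_elt a -> boolean_center (\pi_(rquot F) a) ->
  exists e : A, boolean_center e /\ \pi_(rquot F) e = \pi_(rquot F) a.
Proof.
case=> n [n_gt0 Ban] /boolean_center_idem piaa.
by exists (rpow a n); split=> //; rewrite pi_rpow rpow_idem.
Qed.

Lemma hyperarchimedean_has_BLP : hyperarchimedean A -> has_BLP A.
Proof. by move=> hA F; elim/quotW=> a; apply: archimedean_lift. Qed.

Lemma le_pi_rquot F a b : a <= b -> \pi_(rquot F) a <= \pi_(rquot F) b.
Proof. by move=> leab; apply/qleP/filter_imp_le. Qed.

End Lifting.

Section Chains.
Variable d : Order.disp_t.

Lemma boolean_center_comparable (L : tbLatticeType d) (f g : L) :
    f >=< g -> f `|` g = \top -> f `&` g = \bot -> f = \bot \/ f = \top.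
Proof.
by case/orP=> fg; [rewrite (meet_l fg) | rewrite (join_l fg)]; [left | right].
Qed.

Lemma chain_has_BLP (A : residuatedLatticeType d) :
  (forall a b : A, a >=< b) -> has_BLP A.
Proof.
move=> totA F; elim/quotW=> a [g]; elim/quotW: g => b [ab1 ab0].
have cmp : \pi_(rquot F) a >=< \pi_(rquot F) b.
  by apply/orP; case/orP: (totA a b) => leab; [left | right];
    apply: le_pi_rquot.
have [->|->] := boolean_center_comparable cmp ab1 ab0.
  by exists \bot; split; first exact: boolean_center_bot.
by exists \top; split; first exact: boolean_center_top.
Qed.

End Chains.

(** The bounded chain [T] as a residuated lattice whose product is the meet
    (a Goedel chain).  The alias keeps this structure off [T] itself. *)
Definition goedel (d : Order.disp_t) (T : tbOrderType d) : Type := T.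

Section Goedel.
Variables (d : Order.disp_t) (T : tbOrderType d).

HB.instance Definition _ := Order.TBTotal.on (goedel T).

(** The residual of the meet on a bounded chain. *)
Definition goedel_imp (a b : goedel T) : goedel T :=
  if a <= b then \top else b.

Lemma goedel_residuation (a b c : goedel T) :
  (a <= goedel_imp b c) = (a `&` b <= c).
Proof.
by rewrite /goedel_imp leIx; case: (b <= c); rewrite ?lex1 ?orbT ?orbF.
Qed.

HB.instance Definition _ := isResiduatedLattice.Build d (goedel T)
  (@meetA d (goedel T)) (@meetC d (goedel T)) (@meet1x d (goedel T))
  goedel_residuation.

Lemma goedel_has_BLP : has_BLP (goedel T).
Proof. by apply: chain_has_BLP => a b; apply: (@comparableT d T). Qed.

Lemma goedel_archimedean (a : goedel T) :
  archimedean_elt a -> a = \bot \/ a = \top.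
Proof.
case=> n [n_gt0]; rewrite (rpow_idem (meetxx a) n_gt0) => -[b [ab1 ab0]].
exact: boolean_center_comparable (@comparableT d T a b) ab1 ab0.
Qed.

End Goedel.

Theorem corollary4p18 :
  (forall (d : Order.disp_t) (A : residuatedLatticeType d),
     hyperarchimedean A -> has_BLP A) /\
  (exists (d : Order.disp_t) (A : residuatedLatticeType d),
     has_BLP A /\ ~ hyperarchimedean A).
Proof.
split=> [d A|]; first exact: hyperarchimedean_has_BLP.
exists _, (goedel (bool *l bool)%type); split; first exact: goedel_has_BLP.
(* In the lexicographic order, \bot is (false, false) and \top (true, true). *)
by move/(_ (false, true)) => /goedel_archimedean[].
Qed.
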